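(* FCLP does not imply CBLP; that is, there exists a congruence-distributive algebra which has FCLP but does not have CBLP.
   Context: Algebras are non-empty universal algebras. For an algebra $A$, $\mathrm{Con}(A)$ is the bounded lattice of congruences of $A$ ordered by inclusion, with meet $\cap$, join $\phi\vee\psi$ = the congruence generated by $\phi\cup\psi$, least element $\Delta_A=\{(a,a)\mid a\in A\}$ and greatest element $\nabla_A=A^2$. $A$ is congruence-distributive if the lattice $\mathrm{Con}(A)$ is distributive (e.g. every lattice is a congruence-distributive algebra); quotients of congruence-distributive algebras are congruence-distributive. For a bounded distributive lattice $L$, $\mathcal{B}(L)$ is the Boolean algebra of complemented elements of $L$. Composition: $\phi\circ\psi=\{(a,b)\in A^2\mid \exists x\in A,\ (a,x)\in\psi,\ (x,b)\in\phi\}$. Let $A$ be congruence-distributive. A congruence $\phi$ of $A$ is a factor congruence if there is $\phi^*\in\mathrm{Con}(A)$ with $\phi\vee\phi^*=\nabla_A$, $\phi\cap\phi^*=\Delta_A$ and $\phi\circ\phi^*=\phi^*\circ\phi$. $\mathrm{FC}(A)$ is the set of factor congruences; it is a Boolean subalgebra of $\mathcal{B}(\mathrm{Con}(A))$. For $\theta\in\mathrm{Con}(A)$, the map $u_\theta:\mathrm{Con}(A)\to\mathrm{Con}(A/\theta)$, $u_\theta(\alpha)=(\alpha\vee\theta)/\theta=\{(a/\theta,b/\theta)\mid(a,b)\in\alpha\vee\theta\}$, is a bounded lattice morphism which maps $\mathrm{FC}(A)$ into $\mathrm{FC}(A/\theta)$ and $\mathcal{B}(\mathrm{Con}(A))$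 into $\mathcal{B}(\mathrm{Con}(A/\theta))$. The congruence $\theta$ has FCLP (Factor Congruence Lifting Property) if the restriction $u_\theta|:\mathrm{FC}(A)\to\mathrm{FC}(A/\theta)$ is surjective; $\theta$ has CBLP (Congruence Boolean Lifting Property) if the restriction $u_\theta|:\mathcal{B}(\mathrm{Con}(A))\to\mathcal{B}(\mathrm{Con}(A/\theta))$ is surjective. $A$ has FCLP (respectively CBLP) if every congruence of $A$ has FCLP (respectively CBLP). *)

(* Defs.v *)
From HB Require Import structures.
From mathcomp Require Import all_boot all_order.
From mathcomp Require Import boolp classical_sets functions.

Set Implicit Arguments.
Unset Strict Implicit.
Unset Printing Implicit Defensive.

Import Order.TTheory.
Local Open Scope classical_set_scope.
Local Open Scope quotient_scope.

Record signature := Signature { symbol : Type; arity : symbol -> nat }.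

(* Finitary universal algebras. A choiceType carrier is no restriction, since
   classically every type is one (see {classic T} in boolp); it gives access to
   the quotient types of generic_quotient. *)
Record algebra (S : signature) := Algebra {
  carrier :> choiceType;
  op : forall f : symbol S, (arity f).-tuple carrier -> carrier;
  carrier_nonempty : inhabited carrier }.

Section Congruence.
Context {S : signature} (A : algebra S).

Definition is_congruence : set (set (A * A)) := [set R |
  [/\ forall a, R (a, a),
      forall a b, R (a, b) -> R (b, a),
      forall a b c, R (a, b) -> R (b, c) -> R (a, c) &
      forall (f : symbol S) (s t : (arity f).-tuple A),
        (forall i, R (tnth s i, tnth t i)) -> R (op s, op t)]].

Record congruence := Congruence {
  cgraph :> set (A * A);
  cgraphP : is_congruence cgraph }.

Lemma congruence_inj : injective cgraph.
Proof.
move=> [R RP] [R' RP'] /= e; case: R' / e RP' => RP'.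
by rewrite (Prop_irrelevance RP RP').
Qed.

HB.instance Definition _ := gen_eqMixin congruence.
HB.instance Definition _ := gen_choiceMixin congruence.

Lemma bigcap_congruence (F : set (set (A * A))) :
  F `<=` is_congruence -> is_congruence (\bigcap_(R in F) R).
Proof.
move=> FC; split=> [a R /FC[r _ _ _]|a b ab R FR|a b c ab bc R FR|f s t st R FR].
- exact: r.
- by case: (FC _ FR) => _ h _ _; apply: h (ab _ FR).
- by case: (FC _ FR) => _ _ h _; apply: h (ab _ FR) (bc _ FR).
- by case: (FC _ FR) => _ _ _; apply=> i; apply: st.
Qed.

Lemma diagonal_congruence : is_congruence diagonal.
Proof.
split=> [//|a b /diagonalP-> //|a b c /diagonalP-> //|f s t st].
by apply/diagonalP; congr op; apply: eq_from_tnth => i; exact/diagonalP/st.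
Qed.

Lemma setT_congruence : is_congruence setT.
Proof. by []. Qed.

Lemma setI_congruence (phi psi : congruence) : is_congruence (phi `&` psi).
Proof.
case: phi psi => [R [r1 s1 t1 c1]] [R' [r2 s2 t2 c2]] /=.
split=> [a|a b [? ?]|a b c [? ?] [? ?]|f s t st]; split; eauto.
- by apply: c1 => i; case: (st i).
- by apply: c2 => i; case: (st i).
Qed.

Lemma smallest_congruence (R : set (A * A)) :
  is_congruence (smallest is_congruence R).
Proof. by apply: bigcap_congruence => M []. Qed.

Definition cbot := Congruence diagonal_congruence.
Definition ctop := Congruence setT_congruence.
Definition cmeet (phi psi : congruence) := Congruence (setI_congruence phi psi).
Definition cjoin (phi psi : congruence) :=
  Congruence (smallest_congruence (phi `|` psi)).

Definition cle (phi psi : congruence) : bool := `[< phi `<=` psi >].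

Lemma cle_refl : reflexive cle.
Proof. by move=> phi; apply/asboolP. Qed.

Lemma cle_anti : antisymmetric cle.
Proof.
move=> phi psi /andP[/asboolP le1 /asboolP le2].
by apply: congruence_inj; apply/seteqP.
Qed.

Lemma cle_trans : transitive cle.
Proof.
by move=> ? ? ? /asboolP le1 /asboolP le2; apply/asboolP; apply: subset_trans le2.
Qed.

Fact congruence_display : Order.disp_t. Proof. exact: Order.Disp tt tt. Qed.

HB.instance Definition _ := Order.Le_isPOrder.Build congruence_display
  congruence cle_refl cle_anti cle_trans.

Lemma cleP (phi psi : congruence) : reflect (phi `<=` psi) (phi <= psi)%O.
Proof. exact: asboolP. Qed.

Lemma cmeetP (phi psi chi : congruence) :
  (phi <= cmeet psi chi)%O = (phi <= psi)%O && (phi <= chi)%O.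
Proof.
apply/asboolP/andP => [|[/asboolP ? /asboolP ?]]; rewrite subsetI //.
by move=> [? ?]; split; apply/asboolP.
Qed.

Lemma cjoinP (phi psi chi : congruence) :
  (cjoin phi psi <= chi)%O = (phi <= chi)%O && (psi <= chi)%O.
Proof.
apply/asboolP/andP => [le|[/asboolP le1 /asboolP le2]].
  have := subset_trans (sub_gen_smallest (G := _)) le.
  by rewrite subUset => -[? ?]; split; apply/asboolP.
by apply: smallest_sub; [exact: cgraphP | rewrite subUset].
Qed.

HB.instance Definition _ := Order.POrder_isMeetSemilattice.Build
  congruence_display congruence cmeetP.
HB.instance Definition _ := Order.POrder_isJoinSemilattice.Build
  congruence_display congruence cjoinP.

Lemma cbotP (phi : congruence) : (cbot <= phi)%O.
Proof.
by apply/cleP => -[a b] /diagonalP->; case: (cgraphP phi).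
Qed.

Lemma ctopP (phi : congruence) : (phi <= ctop)%O.
Proof. exact/asboolP. Qed.

HB.instance Definition _ := Order.hasBottom.Build
  congruence_display congruence cbotP.
HB.instance Definition _ := Order.hasTop.Build
  congruence_display congruence ctopP.

Lemma cbotE : cgraph \bot%O = diagonal.
Proof. by []. Qed.

Lemma ctopE : cgraph \top%O = setT.
Proof. by []. Qed.

Lemma cmeetE (phi psi : congruence) :
  cgraph (phi `&` psi)%O = cgraph phi `&` cgraph psi.
Proof. by []. Qed.

Lemma cjoinE (phi psi : congruence) :
  cgraph (phi `|` psi)%O = smallest is_congruence (cgraph phi `|` cgraph psi).
Proof. by []. Qed.

End Congruence.

Definition distributive_lattice d (L : latticeType d) :=
  left_distributive (@Order.meet d L) (@Order.join d L).

(* The Boolean centre B(L) of a bounded distributive lattice L. *)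
Definition complemented d (L : tbLatticeType d) : set L := [set x |
  exists y : L, (x `&` y = \bot)%O /\ (x `|` y = \top)%O].
Arguments complemented {d} L.

Definition congruence_distributive (S : signature) (A : algebra S) :=
  distributive_lattice (congruence A).

(* In [phi \; psi], as in the usual notation for functional composition, the
   relation [psi] is applied first. *)
Definition factor_congruences (S : signature) (A : algebra S) :
    set (congruence A) := [set phi |
  exists phi' : congruence A,
    [/\ (phi `|` phi' = \top)%O, (phi `&` phi' = \bot)%O &
        (cgraph phi \; cgraph phi' = cgraph phi' \; cgraph phi)%relation]].
Arguments factor_congruences {S} A.

Section Quotient.
Context {S : signature} {A : algebra S} (theta : congruence A).

Definition crel : rel A := fun a b => `[< cgraph theta (a, b) >].

Lemma crel_refl : reflexive crel.
Proof. by move=> a; apply/asboolP; case: (cgraphP theta). Qed.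

Lemma crel_sym : symmetric crel.
Proof.
by move=> a b; case: (cgraphP theta) => _ h _ _; apply/asboolP/asboolP; exact: h.
Qed.

Lemma crel_trans : transitive crel.
Proof.
move=> b a c /asboolP ab /asboolP bc; apply/asboolP.
by case: (cgraphP theta) => _ _ h _; exact: h bc.
Qed.

Canonical crel_equiv := EquivRel crel crel_refl crel_sym crel_trans.

Definition quotient_carrier := {eq_quot crel_equiv}.

Definition quotient_op (f : symbol S) (t : (arity f).-tuple quotient_carrier) :
  quotient_carrier := \pi_quotient_carrier (op (map_tuple repr t)).

Lemma quotient_nonempty : inhabited quotient_carrier.
Proof. by case: (carrier_nonempty A) => a; split; exact: \pi_quotient_carrier a. Qed.

Definition quotient : algebra S := Algebra quotient_op quotient_nonempty.

Definition proj (a : A) : quotient := \pi_quotient_carrier a.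

Lemma projP (a b : A) : proj a = proj b <-> cgraph theta (a, b).
Proof.
by rewrite /proj; split => [/eqmodP/asboolP//|ab]; apply/eqmodP/asboolP.
Qed.

Lemma proj_surj (x : quotient) : exists a, proj a = x.
Proof. by exists (repr (x : quotient_carrier)); exact: reprK. Qed.

Lemma proj_op (f : symbol S) (t : (arity f).-tuple A) :
  proj (op t) = op (map_tuple proj t).
Proof.
apply/projP; case: (cgraphP theta) => _ _ _; apply=> i.
by rewrite !tnth_map; apply/projP; rewrite /proj reprK.
Qed.

Definition join_quotient (alpha : congruence A) : set (quotient * quotient) :=
  [set (proj ab.1, proj ab.2) | ab in cgraph (alpha `|` theta)%O].

Lemma join_quotientP (alpha : congruence A) (a b : A) :
  join_quotient alpha (proj a, proj b) <-> cgraph (alpha `|` theta)%O (a, b).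
Proof.
split=> [[[a' b'] /= ab' [/projP aa' /projP bb']]|ab]; last by exists (a, b).
have /cleP le : (theta <= alpha `|` theta)%O by exact: leUr.
case: (cgraphP (alpha `|` theta)%O) => _ s t _.
exact: t (t _ _ _ (s _ _ (le _ aa')) ab') (le _ bb').
Qed.

Lemma join_quotient_congruence (alpha : congruence A) :
  is_congruence (join_quotient alpha).
Proof.
case: (cgraphP (alpha `|` theta)%O) => r s t c; split.
- by move=> x; have [a <-] := proj_surj x; apply/join_quotientP.
- move=> x y; have [a <-] := proj_surj x; have [b <-] := proj_surj y.
  by move=> /join_quotientP ab; apply/join_quotientP; apply: s.
- move=> x y z; have [a <-] := proj_surj x; have [b <-] := proj_surj y.
  have [d <-] := proj_surj z => /join_quotientP ab /join_quotientP bd.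
  by apply/join_quotientP; apply: t bd.
- move=> f u v uv; pose rp (x : quotient) : A := repr (x : quotient_carrier).
  have rpK x : proj (rp x) = x by exact: reprK.
  have lift (w : (arity f).-tuple quotient) :
      w = map_tuple proj (map_tuple rp w).
    by apply: eq_from_tnth => i; rewrite !tnth_map rpK.
  rewrite (lift u) (lift v) -!proj_op; apply/join_quotientP; apply: c => i.
  by apply/join_quotientP; rewrite !tnth_map !rpK.
Qed.

Definition u (alpha : congruence A) : congruence quotient :=
  Congruence (join_quotient_congruence alpha).

End Quotient.

Section LiftingProperties.
Context {S : signature} (A : algebra S).

Definition congruence_FCLP (theta : congruence A) :=
  set_surj (factor_congruences A) (factor_congruences (quotient theta))
    (u theta).

Definition congruence_CBLP (theta : congruence A) :=
  set_surj (complemented (congruence A))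
    (complemented (congruence (quotient theta))) (u theta).

Definition FCLP := forall theta : congruence A, congruence_FCLP theta.
Definition CBLP := forall theta : congruence A, congruence_CBLP theta.

End LiftingProperties.

(* Main.v *)
From mathcomp Require Import all_boot all_order.
From mathcomp Require Import boolp classical_sets functions.
From mathcomp Require Import zify.
Require Import Defs.

(** The witness is the chain 0 < 1 < 2 < 3 with translated meets and joins and
    two further unary operations. Its congruences are convex equivalences,
    so they are determined by the steps (i, i + 1) that they collapse, and the
    extra operations force a nontrivial congruence to collapse the middle step.
    Hence Con(A) is the square 2 x 2 with a new bottom, and the atom theta has
    no CBLP, as Con(A/theta) is Boolean with four elements. On the other hand,
    two permuting complementary congruences of a quotient of a chain with end
    points are trivial: if 0 psi x phi 3 and 0 phi y psi 3, then by convexity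
    phi relates 0 and 3 if x <= y, and psi does otherwise. So FCLP holds. *)

Set Implicit Arguments.
Unset Strict Implicit.
Unset Printing Implicit Defensive.

Import Order.TTheory.
Local Open Scope classical_set_scope.

(** * Permuting congruences and the trivial factor congruences *)

Section GeneralAlgebra.
Context {S : signature} {A : algebra S}.
Implicit Types phi psi : congruence A.

Lemma congruence_refl phi a : cgraph phi (a, a).
Proof. by case: (cgraphP phi). Qed.

Lemma congruence_sym phi a b : cgraph phi (a, b) -> cgraph phi (b, a).
Proof. by case: (cgraphP phi) => _ h _ _; exact: h. Qed.

Lemma congruence_trans phi a b c :
  cgraph phi (a, b) -> cgraph phi (b, c) -> cgraph phi (a, c).
Proof. by case: (cgraphP phi) => _ _ h _; exact: h. Qed.

Lemma eq_top_congruence phi : (forall a b, cgraph phi (a, b)) -> phi = \top%O.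
Proof. by move=> h; apply/le_anti; rewrite lex1; apply/cleP => -[]. Qed.

Lemma eq_bot_congruence phi :
  (forall a b, cgraph phi (a, b) -> a = b) -> phi = \bot%O.
Proof.
move=> h; apply/le_anti; rewrite le0x andbT; apply/cleP => -[a b] /h <-.
exact: congruence_refl.
Qed.

(** Permutability makes the relational composite itself a congruence; it contains [phi] and [psi],
    hence their join. *)
Lemma permuting_join_top phi psi :
    (phi `|` psi = \top)%O ->
    (cgraph phi \; cgraph psi = cgraph psi \; cgraph phi)%relation ->
  forall a b, exists2 x, cgraph phi (a, x) & cgraph psi (x, b).
Proof.
move=> jT perm a b.
have comm x y z : cgraph psi (x, y) -> cgraph phi (y, z) ->
    exists2 t, cgraph phi (x, t) & cgraph psi (t, z).
  move=> xy yz.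
  have : (cgraph phi \; cgraph psi)%relation (x, z) by exists y.
  by rewrite perm.
have QP : is_congruence (cgraph psi \; cgraph phi)%relation.
  split=> [x|x y [t xt ty]|x y z [t xt ty] [v yv vz]|f s t st] /=.
  - by exists x => /=; exact: congruence_refl.
  - exact: comm (congruence_sym ty) (congruence_sym xt).
  - have [w tw wv] := comm _ _ _ ty yv.
    by exists w; [exact: congruence_trans xt tw|exact: congruence_trans wv vz].
  - have /boolp.choice [w hw] : forall i, exists v : A,
        cgraph phi (tnth s i, v) /\ cgraph psi (v, tnth t i).
      by move=> i; have [v ? ?] := st i; exists v.
    exists (op [tuple w i | i < arity f]).
    + case: (cgraphP phi) => _ _ _; apply=> i.
      by rewrite tnth_mktuple; case: (hw i).
    + case: (cgraphP psi) => _ _ _; apply=> i.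
      by rewrite tnth_mktuple; case: (hw i).
suff /cleP : (\top <= Congruence QP)%O by move=> /(_ (a, b)); apply.
rewrite -jT leUx; apply/andP; split; apply/cleP => -[x y] /= xy.
  by exists y => //; exact: congruence_refl.
by exists x => //; exact: congruence_refl.
Qed.

Lemma bot_factor : factor_congruences A \bot%O.
Proof.
exists \top%O; rewrite joinx1 meetx1; split=> //.
apply/seteqP; split=> -[a b] /= [x _ _]; [exists a|exists b] => //;
  exact: (congruence_refl \bot%O).
Qed.

Lemma top_factor : factor_congruences A \top%O.
Proof.
exists \bot%O; rewrite join1x meet1x; split=> //.
apply/seteqP; split=> -[a b] /= [x _ _]; [exists b|exists a] => //;
  exact: (congruence_refl \bot%O).
Qed.

End GeneralAlgebra.

(** * Congruences of a quotient, seen in the algebra *)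

Section QuotientCongruences.
Context {S : signature} {A : algebra S}.
Implicit Types theta : congruence A.

Lemma u_bot theta : u theta \bot%O = \bot%O.
Proof.
apply: eq_bot_congruence => x y.
have [a <-] := proj_surj x; have [b <-] := proj_surj y.
by move=> /join_quotientP; rewrite join0x => /projP.
Qed.

Lemma u_top theta : u theta \top%O = \top%O.
Proof.
apply: eq_top_congruence => x y.
have [a <-] := proj_surj x; have [b <-] := proj_surj y.
by apply/join_quotientP; rewrite join1x.
Qed.

Lemma pullback_subproof theta (phi : congruence (quotient theta)) :
  is_congruence [set ab : A * A | cgraph phi (proj theta ab.1, proj theta ab.2)].
Proof.
split=> [a|a b|a b c|f s t st] /=.
- exact: congruence_refl.
- exact: congruence_sym.
- exact: congruence_trans.
- rewrite !proj_op; case: (cgraphP phi) => _ _ _; apply=> i.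
  by rewrite !tnth_map; exact: st.
Qed.

Definition pullback theta (phi : congruence (quotient theta)) :=
  Congruence (pullback_subproof phi).

Lemma pullback_top theta (phi : congruence (quotient theta)) :
  pullback phi = \top%O -> phi = \top%O.
Proof.
move=> e; apply: eq_top_congruence => x y.
have [a <-] := proj_surj x; have [b <-] := proj_surj y.
by change (cgraph (pullback phi) (a, b)); rewrite e.
Qed.

End QuotientCongruences.

(** * The four-element chain *)

Inductive chain_symbol := Max of 'I_4 | Min of 'I_4 | Up | Down.

Definition chain_signature := Signature (fun _ : chain_symbol => 1).

(** [Up] sends 0, 1, 2, 3 to 1, 2, 2, 3, so it moves step 0 onto step 1; [Down] sends them to 0, 1,
    1, 2 and moves step 2 onto step 1. *)
Definition chain_act (s : chain_symbol) (a : nat) : nat :=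
  match s with
  | Max c => maxn c a
  | Min c => minn c a
  | Up => a + (a < 2)
  | Down => a - (1 < a)
  end.

Lemma chain_act_lt s a : a < 4 -> chain_act s a < 4.
Proof. case: s => [c|c||] /=; try have := ltn_ord c; lia. Qed.

Definition chain : algebra chain_signature :=
  @Algebra chain_signature 'I_4
    (fun s t => inord (chain_act s (tnth t ord0))) (inhabits ord0).

(** * Congruences of the chain as sets of steps *)

Implicit Types R : congruence chain.

(** A genuine step only for [i < 3]: [inord 4] defaults to 0, so [i = 3] would relate the two end
    points. *)
Notation collapses R i := (cgraph R (inord i : 'I_4, inord i.+1 : 'I_4)).

Lemma chain_congruence_act R s (a b : nat) : a < 4 -> b < 4 ->
  cgraph R (inord a : 'I_4, inord b : 'I_4) ->
  cgraph R (inord (chain_act s a) : 'I_4, inord (chain_act s b) : 'I_4).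
Proof.
move=> a4 b4 ab; case: (cgraphP R) => _ _ _ h.
have := h s [tuple inord a] [tuple inord b].
rewrite /= /tnth /= !inordK //; apply=> i.
by rewrite (ord1 i).
Qed.

(** The translation sending [x] to [maxn i (minn j x)] maps [a] to [i] and [b] to [j]. *)
Lemma chain_congruence_convex R (a b i j : nat) :
  a <= i -> i <= j -> j <= b -> b < 4 ->
  cgraph R (inord a : 'I_4, inord b : 'I_4) ->
  cgraph R (inord i : 'I_4, inord j : 'I_4).
Proof.
move=> ai ij jb b4 ab; have a4 : a < 4 by lia.
have := chain_congruence_act (Min (inord j)) a4 b4 ab.
move=> /(chain_congruence_act (Max (inord i))) /=; rewrite !inordK; try lia.
have -> : maxn i (minn j a) = i by lia.
have -> : maxn i (minn j b) = j by lia.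
by apply; lia.
Qed.

Lemma chain_congruence_steps R (a b : nat) : a <= b -> b < 4 ->
  (forall i, a <= i < b -> collapses R i) ->
  cgraph R (inord a : 'I_4, inord b : 'I_4).
Proof.
move=> ab b4; elim: b ab b4 => [|b IH] ab b4 h.
  by move: ab; rewrite leqn0 => /eqP->; exact: congruence_refl.
have [->|ne] := eqVneq a b.+1; first exact: congruence_refl.
apply: (@congruence_trans _ chain R _ (inord b)); last by apply: h; lia.
by apply: IH; [lia|lia|move=> i ?; apply: h; lia].
Qed.

Lemma chain_congruenceP R (a b : 'I_4) :
  cgraph R (a, b) <-> forall i, minn a b <= i < maxn a b -> collapses R i.
Proof.
have a4 := ltn_ord a; have b4 := ltn_ord b.
wlog ab : a b a4 b4 / a <= b.
  move=> wl; have [ab|ba] := orP (leq_total a b); first exact: wl.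
  by rewrite minnC maxnC -wl //; split; exact: congruence_sym.
rewrite -{1}(inord_val a) -{1}(inord_val b); split=> h.
  move=> i ?; apply: chain_congruence_convex h; lia.
by apply: chain_congruence_steps => // i ?; apply: h; lia.
Qed.

Lemma collapses_middle R i : i < 3 -> collapses R i -> collapses R 1.
Proof.
case: i => [|[|[|//]]] _ //.
  exact: (chain_congruence_act Up).
exact: (chain_congruence_act Down).
Qed.

Section CongruenceOfSteps.
Context (D : set nat) (D1 : forall i, i < 3 -> D i -> D 1).

(** Converse of [collapses_middle]: the condition [D1] is all that a set of steps must satisfy to
    come from a congruence. *)
Lemma steps_subproof : @is_congruence _ chain
  [set ab : 'I_4 * 'I_4 | forall i, minn ab.1 ab.2 <= i < maxn ab.1 ab.2 -> D i].
Proof.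
split=> [a i|a b h i|a b c h h' i|s x y h i] /=.
- lia.
- by rewrite minnC maxnC; exact: h.
- move=> /= ?; case: (boolP (minn a b <= i < maxn a b)) => [/h //|?].
  by apply: h' => /=; lia.
- have {h} := h ord0; move: (tnth x ord0) (tnth y ord0) => a b /= hD.
  have a4 := ltn_ord a; have b4 := ltn_ord b.
  rewrite !inordK ?chain_act_lt //; case: s {x y} => [c|c||] /= hi.
  + by apply: hD; lia.
  + by apply: hD; lia.
  (* A step other than 1 between the images already lies between [a] and [b]. Step 1 may instead
     come from step 0 under [Up], or from step 2 under [Down] below; then [D1] applies. *)
  + have [i1|?] := eqVneq i 1; last by apply: hD; lia.
    have [h1|?] := boolP (minn a b <= 1 < maxn a b); rewrite i1;
      first exact: hD.
    by apply: (@D1 0) => //; apply: hD; lia.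
  + have [i1|?] := eqVneq i 1; last by apply: hD; lia.
    have [h1|?] := boolP (minn a b <= 1 < maxn a b); rewrite i1;
      first exact: hD.
    by apply: (@D1 2) => //; apply: hD; lia.
Qed.

Definition congruence_of_steps : congruence chain := Congruence steps_subproof.

Lemma collapses_of_steps i : i < 3 -> collapses congruence_of_steps i <-> D i.
Proof.
move=> i3; split=> /= [/(_ i)|Di j]; rewrite !inordK; try lia.
  by apply; lia.
by move=> ?; have -> : j = i by lia.
Qed.

End CongruenceOfSteps.

Lemma chain_congruence_le R R' :
  (forall i, i < 3 -> collapses R i -> collapses R' i) -> (R <= R')%O.
Proof.
move=> h; apply/cleP => -[a b] /chain_congruenceP ab.
apply/chain_congruenceP => i ?.
by apply: h; [have := ltn_ord a; have := ltn_ord b; lia|exact: ab].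
Qed.

(** The union of the two step sets still satisfies the condition on the middle step, so it defines a
    congruence above both. Joins are thus computed stepwise, which gives distributivity. *)
Lemma collapses_join R R' i : i < 3 ->
  collapses (R `|` R')%O i <-> collapses R i \/ collapses R' i.
Proof.
move=> i3; split; last first.
  case; [have /cleP := leUl R R'|have /cleP := leUr R' R]; exact.
pose D := [set i | collapses R i \/ collapses R' i].
have D1 j : j < 3 -> D j -> D 1.
  by move=> j3 [?|?]; [left|right]; exact: (@collapses_middle _ j).
have /cleP le : (R `|` R' <= congruence_of_steps D1)%O.
  by rewrite leUx; apply/andP; split; apply: chain_congruence_le => j j3 hj;
    apply/collapses_of_steps => //; [left|right].
by move=> /le /collapses_of_steps; apply.
Qed.

Lemma chain_congruence_distributive : congruence_distributive chain.
Proof.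
move=> x y z; apply/le_anti; apply/andP; split; last first.
  by rewrite leUx !leI2 ?leUl ?leUr.
apply: chain_congruence_le => i i3; rewrite cmeetE => -[/collapses_join].
by move=> /(_ i3)[?|?] ?; apply/collapses_join => //; [left|right].
Qed.

Lemma chain_congruence_top R :
  cgraph R (inord 0 : 'I_4, inord 3 : 'I_4) -> R = \top%O.
Proof.
move=> h; apply/le_anti; rewrite lex1; apply: chain_congruence_le => i i3 _.
by apply: chain_congruence_convex h; lia.
Qed.

(** * Factor congruences of the quotients, and FCLP *)

Lemma factor_congruences_chain_quotient (theta : congruence chain)
    (phi : congruence (quotient theta)) :
  factor_congruences (quotient theta) phi -> phi = \bot%O \/ phi = \top%O.
Proof.
have lift (chi chi' : congruence (quotient theta)) :
    (chi `|` chi' = \top)%O ->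
    (cgraph chi \; cgraph chi' = cgraph chi' \; cgraph chi)%relation ->
    exists2 x, x < 4 &
      cgraph (pullback chi) (inord 0 : 'I_4, inord x : 'I_4) /\
      cgraph (pullback chi') (inord x : 'I_4, inord 3 : 'I_4).
  move=> j p.
  have [x] := permuting_join_top j p (proj theta (inord 0 : 'I_4))
                (proj theta (inord 3 : 'I_4)).
  have [a <-] := proj_surj x => ? ?.
  by exists (a : 'I_4) => //; rewrite inord_val.
move=> [psi [j m p]].
have [y y4 [y0 y3]] := lift _ _ j p.
(* Exchanging the roles of [phi] and [psi] gives a second path from 0 to 3; the two midpoints are
   then compared in the chain. *)
have [x x4 [x0 x3]] := lift psi phi (etrans (joinC _ _) j) (esym p).
have [xy|/ltnW yx] := leqP x y.
  right; apply/pullback_top/chain_congruence_top; apply: congruence_trans x3.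
  by apply: chain_congruence_convex y0.
left; suff psiT : psi = \top%O by rewrite -m psiT meetx1.
apply/pullback_top/chain_congruence_top; apply: congruence_trans y3.
by apply: chain_congruence_convex x0.
Qed.

Lemma chain_FCLP : FCLP chain.
Proof.
move=> theta phi /factor_congruences_chain_quotient [->|->].
- by exists \bot%O; [exact: bot_factor|exact: u_bot].
- by exists \top%O; [exact: top_factor|exact: u_top].
Qed.

(** * Complemented congruences, and the failure of CBLP *)

Lemma chain_congruence_bot R : ~ collapses R 1 -> R = \bot%O.
Proof.
move=> h; apply/le_anti; rewrite le0x andbT.
by apply: chain_congruence_le => i i3 /(collapses_middle i3).
Qed.

(** Two nontrivial congruences both collapse step 1, so their meet is nontrivial too. *)
Lemma complemented_chain R :
  complemented (congruence chain) R -> R = \bot%O \/ R = \top%O.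
Proof.
move=> [R' [m j]]; have [h|/chain_congruence_bot] := pselect (collapses R 1);
  last by left.
have [h'|/chain_congruence_bot R'0] := pselect (collapses R' 1).
  have : collapses (R `&` R')%O 1 by [].
  by rewrite m cbotE => /diagonalP /(congr1 val) /=; rewrite !inordK.
by right; rewrite -j R'0 joinx0.
Qed.

Lemma chain_not_CBLP : ~ CBLP chain.
Proof.
have D1 k i : i < 3 -> [set 1; k] i -> [set 1; k] 1 by left.
(* The step set is 1 together with [k]: [alpha 1] is the atom, [alpha 0] and [alpha 2] are the two
   coatoms. *)
pose alpha k := congruence_of_steps (D1 k).
pose theta := alpha 1.
have alphaE k i : i < 3 ->
    collapses (alpha k `|` theta)%O i <-> [set 1; k] i.
  move=> i3; split=> [/(collapses_join _ _ i3)[]|ik].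
  - by move/(collapses_of_steps (D1 k) i3).
  - by move/(collapses_of_steps (D1 1) i3) => [] ->; left.
  - by apply/collapses_join => //; left; apply/collapses_of_steps.
have uP k i : i < 3 -> [set 1; k] i -> collapses (pullback (u theta (alpha k))) i.
  by move=> i3 ik; apply/join_quotientP/alphaE.
(* The coatoms meet in [theta] and together collapse all three steps, so their images are
   complements. *)
have compl : complemented (congruence (quotient theta)) (u theta (alpha 0)).
  exists (u theta (alpha 2)); split.
    apply: eq_bot_congruence => x y; rewrite cmeetE.
    have [a <-] := proj_surj x; have [b <-] := proj_surj y.
    move=> [/join_quotientP ab0 /join_quotientP ab2]; apply/projP.
    have /cleP : ((alpha 0 `|` theta) `&` (alpha 2 `|` theta) <= theta)%O.
      apply: chain_congruence_le => i i3; rewrite cmeetE.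
      move=> [/(alphaE _ _ i3) i0 /(alphaE _ _ i3) i2].
      by apply/collapses_of_steps => //=; case: i0 i2 => /= -> [] //=; left.
    by apply.
  apply/pullback_top/chain_congruence_top/chain_congruence_steps => // i i3.
  have /cleP le0 := leUl (u theta (alpha 0)) (u theta (alpha 2)).
  have /cleP le2 := leUr (u theta (alpha 2)) (u theta (alpha 0)).
  have [i2|i2] := eqVneq i 2.
    by apply: le2; apply: uP; [lia|right].
  apply: le0; apply: uP; first lia.
  by have [->|?] := eqVneq i 1; [left|right => /=; lia].
(* A complemented lift would be trivial, but the image of [alpha 0] collapses step 0 and not step 2,
   so it is neither bottom nor top. *)
move=> /(_ theta _ compl)[R /complemented_chain [->|->]].
  rewrite u_bot => e.
  have : collapses (pullback (u theta (alpha 0))) 0 by apply: uP => //; right.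
  rewrite -e => /diagonalP /projP /(collapses_of_steps (D1 1)) []//.
rewrite u_top => e.
have : collapses (pullback (u theta (alpha 0))) 2 by rewrite -e.
by move=> /join_quotientP /alphaE []//.
Qed.

Theorem corollary5p13 :
  exists (S : signature) (A : algebra S),
    congruence_distributive A /\ FCLP A /\ ~ CBLP A.
Proof.
exists chain_signature, chain; split; first exact: chain_congruence_distributive.
by split; [exact: chain_FCLP|exact: chain_not_CBLP].
Qed.
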